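(* Let $\{a_n\}_{n\ge1}$ and $\{c_n\}_{n\ge1}$ be sequences of positive real numbers, and for each positive integer $n$ put $$R_n^{-} = n\frac{a_n}{a_{n+1}}-(n+1)-c_{n+1}, \qquad R_n^{+} = n\frac{a_n}{a_{n+1}}-(n+1)+c_{n+1}.$$ Suppose that $\liminf_{n\to\infty} R_n^{-} = R_1$ and $\limsup_{n\to\infty} R_n^{+} = R_2$. (i) If $R_1>0$, then $\sum c_n a_n$ converges. (ii) If $R_2<0$ and $\sum \frac{c_n}{n}$ diverges, then $\sum c_n a_n$ diverges. *)

(* Defs.v *)
From Stdlib Require Import Reals.
From Coquelicot Require Import Coquelicot.
Open Scope R_scope.

(* Sequences indexed by n >= 1 are functions on nat whose value at 0 is
   irrelevant: it affects neither the limits superior and inferior of the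
   quantities below nor the series, which start at index 1. *)

Definition R_minus (a c : nat -> R) (n : nat) : R :=
  INR n * (a n / a (n + 1)%nat) - (INR n + 1) - c (n + 1)%nat.

Definition R_plus (a c : nat -> R) (n : nat) : R :=
  INR n * (a n / a (n + 1)%nat) - (INR n + 1) + c (n + 1)%nat.

(* Convergence of u 1 + u 2 + ..., since Coquelicot's series start at 0. *)
Definition series1_converges (u : nat -> R) : Prop :=
  ex_series (fun k : nat => u (S k)).

(* Main.v *)
Require Import Defs.
From Stdlib Require Import Reals Lra Lia.
From Coquelicot Require Import Coquelicot.
Open Scope R_scope.

(** Everything is governed by the sequence [b n = n * a n].  Multiplying
    [R_minus] and [R_plus] at [n] by [a (n + 1) > 0] turns them into
    [b n - b (n + 1) -+ c (n + 1) * a (n + 1)], and the limits inferior and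
    superior are used only for the eventual sign of these quantities.

    In the first case, eventually [c (n + 1) * a (n + 1) < b n - b (n + 1)],
    so the tail of the series is dominated by a telescoping sum whose partial
    sums stay below its first term, since [b] is nonnegative
    ([ex_series_le_telescope]).  In the second case, [b] is eventually
    increasing, hence bounded below by some [K > 0], so that
    [a n >= K / n] and [c n / n <= / K * (c n * a n)]: convergence of the
    series of [c n * a n] would force that of the series of [c n / n]. *)

Lemma is_LimInf_seq_gt_eventually (u : nat -> R) (l : Rbar) (x : R) :
  is_LimInf_seq u l -> Rbar_lt x l -> eventually (fun n => x < u n).
Proof.
  destruct l as [l| |]; simpl; intros Hu Hx.
  - assert (He : 0 < l - x) by lra.
    destruct (Hu (mkposreal _ He)) as [_ [N HN]]; simpl in HN.
    exists N; intros n Hn; specialize (HN n Hn); lra.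
  - exact (Hu x).
  - contradiction.
Qed.

Lemma is_LimSup_seq_lt_eventually (u : nat -> R) (l : Rbar) (x : R) :
  is_LimSup_seq u l -> Rbar_lt l x -> eventually (fun n => u n < x).
Proof.
  destruct l as [l| |]; simpl; intros Hu Hx.
  - assert (He : 0 < x - l) by lra.
    destruct (Hu (mkposreal _ He)) as [_ [N HN]]; simpl in HN.
    exists N; intros n Hn; specialize (HN n Hn); lra.
  - contradiction.
  - exact (Hu x).
Qed.

(** The partial sums from [N] on increase and, by telescoping together with
    [0 <= b], never exceed [b N]. *)
Lemma ex_series_le_telescope (u b : nat -> R) :
  eventually (fun n => 0 <= u n <= b n - b (S n)) ->
  eventually (fun n => 0 <= b n) ->
  ex_series u.
Proof.
  intros Hu Hb.
  destruct (filter_and _ _ Hu Hb) as [N HN].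
  apply (ex_series_incr_n u N).
  set (v := fun k => u (N + k)%nat).
  assert (Hsum : forall n, sum_n v n <= b N - b (N + S n)%nat).
  { induction n as [|n IH].
    - rewrite sum_O; unfold v.
      destruct (HN (N + 0)%nat ltac:(lia)) as [H _].
      replace (N + 1)%nat with (S N) by lia.
      rewrite Nat.add_0_r in *; lra.
    - rewrite sum_Sn; unfold plus; simpl.
      destruct (HN (N + S n)%nat ltac:(lia)) as [H _].
      replace (N + S (S n))%nat with (S (N + S n)) by lia.
      unfold v at 2; lra. }
  apply (ex_finite_lim_seq_incr (sum_n v) (b N)); intros n.
  - rewrite sum_Sn; unfold plus; simpl.
    destruct (HN (N + S n)%nat ltac:(lia)) as [H _].
    unfold v at 3; lra.
  - destruct (HN (N + S n)%nat ltac:(lia)) as [_ H].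
    specialize (Hsum n); lra.
Qed.

Lemma ex_series_le_scal_eventually (u v : nat -> R) (K : R) :
  eventually (fun n => 0 <= u n <= K * v n) -> ex_series v -> ex_series u.
Proof.
  intros [N HN] Hv.
  apply (ex_series_incr_n u N).
  apply (@ex_series_le R_AbsRing R_CompleteNormedModule)
    with (b := fun k => K * v (N + k)%nat).
  - intros k; destruct (HN (N + k)%nat ltac:(lia)) as [H0 H1].
    unfold norm; simpl; unfold abs; simpl.
    rewrite Rabs_pos_eq; assumption.
  - apply (@ex_series_scal R_AbsRing R_NormedModule K (fun k => v (N + k)%nat)).
    exact (proj1 (ex_series_incr_n v N) Hv).
Qed.

Lemma nondecreasing_from (b : nat -> R) (N : nat) :
  (forall n, (N <= n)%nat -> b n <= b (S n)) ->
  forall n, (N <= n)%nat -> b N <= b n.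
Proof.
  intros H n Hn; induction Hn as [|n Hn IH]; [lra|].
  specialize (H n Hn); lra.
Qed.

Lemma R_minus_mul (a c : nat -> R) (n : nat) : 0 < a (S n) ->
  R_minus a c n * a (S n) =
  INR n * a n - INR (S n) * a (S n) - c (S n) * a (S n).
Proof.
  intros H; unfold R_minus; rewrite Nat.add_1_r, S_INR; field; lra.
Qed.

Lemma R_plus_mul (a c : nat -> R) (n : nat) : 0 < a (S n) ->
  R_plus a c n * a (S n) =
  INR n * a n - INR (S n) * a (S n) + c (S n) * a (S n).
Proof.
  intros H; unfold R_plus; rewrite Nat.add_1_r, S_INR; field; lra.
Qed.

Theorem theorem4p1 (a c : nat -> R) (R1 R2 : Rbar)
  (ha : forall n : nat, (1 <= n)%nat -> 0 < a n)
  (hc : forall n : nat, (1 <= n)%nat -> 0 < c n)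
  (hR1 : is_LimInf_seq (R_minus a c) R1)
  (hR2 : is_LimSup_seq (R_plus a c) R2) :
  (Rbar_lt 0 R1 -> series1_converges (fun n : nat => c n * a n)) /\
  (Rbar_lt R2 0 -> ~ series1_converges (fun n : nat => c n / INR n) ->
     ~ series1_converges (fun n : nat => c n * a n)).
Proof.
  assert (hca : forall n, 0 < c (S n) * a (S n)).
  { intros n; apply Rmult_lt_0_compat; [apply hc | apply ha]; lia. }
  split.
  - intros Hpos.
    destruct (is_LimInf_seq_gt_eventually _ _ _ hR1 Hpos) as [N HN].
    apply ex_series_le_telescope with (b := fun n => INR n * a n).
    + exists N; intros n Hn.
      assert (Ha : 0 < a (S n)) by (apply ha; lia).
      pose proof (Rmult_lt_0_compat _ _ (HN n Hn) Ha) as H.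
      rewrite R_minus_mul in H by exact Ha.
      specialize (hca n); lra.
    + exists 1%nat; intros n Hn.
      apply Rmult_le_pos; [apply pos_INR | apply Rlt_le, ha, Hn].
  - intros Hneg Hdiv Hconv; apply Hdiv.
    destruct (is_LimSup_seq_lt_eventually _ _ _ hR2 Hneg) as [N HN].
    set (b := fun n => INR n * a n).
    (* The bound [K = b M] must be positive, which fails at index 0. *)
    set (M := S N).
    assert (Hmono : forall n, (M <= n)%nat -> b M <= b n).
    { apply nondecreasing_from; intros n Hn.
      assert (Ha : 0 < a (S n)) by (apply ha; lia).
      assert (H : 0 < (- R_plus a c n) * a (S n)).
      { apply Rmult_lt_0_compat; [|exact Ha].
        specialize (HN n ltac:(unfold M in Hn; lia)); lra. }
      rewrite Ropp_mult_distr_l_reverse, R_plus_mul in H by exact Ha.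
      unfold b; specialize (hca n); lra. }
    assert (HK : 0 < b M).
    { apply Rmult_lt_0_compat; [apply lt_0_INR | apply ha]; unfold M; lia. }
    apply (ex_series_le_scal_eventually _ (fun n => c (S n) * a (S n)) (/ b M));
      [|exact Hconv].
    exists M; intros n Hn.
    assert (Hc : 0 < c (S n)) by (apply hc; lia).
    assert (HI : 0 < INR (S n)) by (apply lt_0_INR; lia).
    split; [apply Rlt_le, Rdiv_lt_0_compat; assumption|].
    specialize (Hmono (S n) ltac:(lia)).
    replace (/ b M * (c (S n) * a (S n)))
      with (c (S n) / INR (S n) * (b (S n) / b M)) by (unfold b at 1; field; lra).
    rewrite <- (Rmult_1_r (c (S n) / INR (S n))) at 1.
    apply Rmult_le_compat_l; [apply Rlt_le, Rdiv_lt_0_compat; assumption|].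
    apply Rle_div_r; lra.
Qed.
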